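(* Let $A\subset\mathbb R^d$ be a finite set affinely spanning $\mathbb R^d$, let $\infty\in\mathbb R^d$, and put $\widetilde A=A\cup\{\infty\}$, $\widetilde Q=\mathrm{Conv}(\widetilde A)$. Assume that $\infty$ is a vertex of $\widetilde Q$ (and $\infty\notin A$) and that $\widetilde A$ is in general position. Let $\widetilde{\mathfrak g}=\mathfrak g_{\widetilde A}$ be the geometric $L_\infty$-algebra of $\widetilde A$, and decompose it as a vector space as $\widetilde{\mathfrak g}=\mathfrak g\oplus\mathfrak g_\infty$, where $\mathfrak g$ (resp. $\mathfrak g_\infty$) is spanned by the summands corresponding to finite (resp. infinite) subpolytopes. Then both $\mathfrak g$ and $\mathfrak g_\infty$ are $L_\infty$-subalgebras of $\widetilde{\mathfrak g}$, and moreover $\mathfrak g_\infty$ is an $L_\infty$-ideal. In other words, $\widetilde{\mathfrak g}$ is the semi-direct product $\mathfrak g\ltimes\mathfrak g_\infty$.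
   Context: General position: any $p\le d+1$ points are the vertices of a $(p-1)$-simplex. A subpolytope $Q'\subset(\widetilde Q,\widetilde A)$ is a $d$-dimensional convex polytope with vertices in $\widetilde A$; it is finite if its vertices lie in $A$, and infinite if $\infty\in Q'$. It is marked by $\widetilde A\cap Q'$ (geometric marking). Definition of the geometric $L_\infty$-algebra $\mathfrak g_B$ of a finite set $B\subset\mathbb R^d$ in general position and affinely spanning $\mathbb R^d$. For $B'\subset B$ with $Q'=\mathrm{Conv}(B')$ of dimension $d$, a polyhedral subdivision of $(Q',B')$ is a collection $\{(Q''_\nu,B''_\nu)\}$ with $B''_\nu\subset B'$, $Q''_\nu=\mathrm{Conv}(B''_\nu)$ $d$-dimensional, $\bigcup Q''_\nu=Q'$, each $Q''_\nu\cap Q''_\mu$ a common face, and $B''_\nu,B''_\mu$ agreeing on $Q''_\nu\cap Q''_\mu$. It is regular if some continuous convex function on $Q'$ has exactly the $Q''_\nu$ as maximal domains of affine linearity. The secondary polytope $\Sigma(B')\subset\mathbb R^{B'}$ is the convex hull of $\phi_T(\omega)=\sum_{\Delta\in T,\,\omega\in\mathrm{Vert}\Delta}\mathrm{Vol}(\Delta)$ over regular triangulations $T$ of $(Q',B')$; its faces $F_{\mathcal P}$ correspond bijectively (order-preserving for refinement) to regular subdivisions $\mathcal P$, with $F_{\mathcal P}\cong\prod_\nu\Sigma(B''_\nu)$; $\mathcal P$ is coarse if $F_{\mathcal P}$ has codimension 1. Over a field $\mathbf k$ of characteristic 0 put $\mathrm{or}(F)=H_c^{\dim F}(\mathrm{Int}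 F,\mathbf k)$, $V_{B'}=\mathrm{or}(\Sigma(B'))[\dim\Sigma(B')]$, $V=\bigoplus_{B'}V_{B'}$; $S^\bullet(V)$ has the derivation differential whose restriction to $V_{B'}$ is the sum over coarse $\mathcal P$ of the cellular chain boundary components $V_{B'}\to\bigodot_\nu V_{B''_\nu}\cong\mathrm{or}(F_{\mathcal P})[\dim F_{\mathcal P}]$. This is an $L_\infty$-structure on $V^*[-1]=\bigoplus_{B'}E_{B'}$, $E_{B'}=\mathrm{or}(\Sigma(B'))^*[-1-\dim\Sigma(B')]$ (an $L_\infty$-structure on $\mathfrak h$ being an algebra differential on $S^\bullet(\mathfrak h^*[-1])$ preserving $S^\bullet_+$). $\mathfrak g_B$ is the $L_\infty$-subalgebra $\bigoplus_{Q'}E_{B\cap Q'}$, the sum over $d$-dimensional polytopes $Q'$ with vertices in $B$. An $L_\infty$-ideal is a graded subspace $I$ such that $\lambda_n(x_1,\dots,x_n)\in I$ for all $n\geq 1$ whenever at least one $x_i\in I$. *)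

(* Defs.v *)
From HB Require Import structures.
From mathcomp Require Import all_boot all_order all_algebra finmap.
From mathcomp Require Import all_classical all_reals all_analysis.

Set Implicit Arguments.
Unset Strict Implicit.
Unset Printing Implicit Defensive.

Import Order.TTheory GRing.Theory Num.Theory.
Import numFieldNormedType.Exports.

Local Open Scope classical_set_scope.
Local Open Scope ring_scope.

(** * Convex geometry in R^d *)

Definition convex_hull (R : realType) (V : lmodType R) (S : set V) : set V :=
  smallest (@convex_set R V) S.

Definition affine_hull (R : realType) (V : lmodType R) (S : set V) : set V :=
  [set x | exists (n : nat) (v : 'I_n -> V) (c : 'I_n -> R),
    [/\ forall i, S (v i), \sum_(i < n) c i = 1
      & x = \sum_(i < n) c i *: v i]].

(* For nonempty S this says that the convex hull of S has dimension d. *)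
Definition affinely_spanning (R : realType) (d : nat) (S : set 'rV[R]_d) :=
  affine_hull S = setT.

(* Faces cut out by a supporting affine functional; the empty face and Q
   itself are included (take l = 0 and c = 1, resp. c = 0). *)
Definition face_of (R : realType) (d : nat) (Q F : set 'rV[R]_d) : Prop :=
  exists (l : 'cV[R]_d) (c : R),
    (forall x, Q x -> (x *m l) 0 0 <= c) /\
    F = Q `&` [set x | (x *m l) 0 0 = c].

Definition vertex_of (R : realType) (d : nat) (Q : set 'rV[R]_d)
  (v : 'rV[R]_d) : Prop := face_of Q [set v].

Definition affine_on (R : realType) (d : nat) (D : set 'rV[R]_d)
    (f : 'rV[R]_d -> R) : Prop :=
  exists (l : 'cV[R]_d) (c : R), forall x, D x -> f x = (x *m l) 0 0 + c.

(* Domains of affine linearity are required to be convex: x |-> |x| agrees with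
   a constant on {-1, 1}, which is not meant to count as a domain. *)
Definition linearity_domain (R : realType) (d : nat) (Q : set 'rV[R]_d)
    (f : 'rV[R]_d -> R) (D : set 'rV[R]_d) : Prop :=
  [/\ D `<=` Q, convex_set (D : set (convex_lmodType 'rV[R]_d))
    & affine_on D f].

Definition maximal_linearity_domain (R : realType) (d : nat)
    (Q : set 'rV[R]_d) (f : 'rV[R]_d -> R) (D : set 'rV[R]_d) : Prop :=
  linearity_domain Q f D /\
  forall D', linearity_domain Q f D' -> D `<=` D' -> D' = D.

(** * Marked polytopes, subdivisions and secondary polytopes *)

(* B is the ambient finite point set; a marked polytope (Q', B') with
   Q' = Conv(B') is given by its marking B' : {set B}. *)
Section Secondary.
Variables (R : realType) (d : nat) (B : {fset 'rV[R]_d}).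

Definition points (C : {set B}) : set 'rV[R]_d := [set fsval p | p in [set` C]].

Definition polytope (C : {set B}) : set 'rV[R]_d := convex_hull (points C).

Definition affinely_independent (C : {set B}) : Prop :=
  forall c : B -> R, (forall p, p \notin C -> c p = 0) ->
    \sum_p c p = 0 -> \sum_p c p *: fsval p = 0 -> forall p, c p = 0.

Definition general_position : Prop :=
  forall C : {set B}, (#|C| <= d.+1)%N -> affinely_independent C.

Definition full_dim (C : {set B}) : Prop := affinely_spanning (points C).

Definition subdivision (B' : {set B}) (P : {set {set B}}) : Prop :=
  [/\ forall C, C \in P -> C \subset B' /\ full_dim C,
      \bigcup_(C in [set` P]) polytope C = polytope B',
      forall C D, C \in P -> D \in P ->
        face_of (polytope C) (polytope C `&` polytope D) /\
        face_of (polytope D) (polytope C `&` polytope D)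
    & forall C D, C \in P -> D \in P ->
        forall p : B, (polytope C `&` polytope D) (fsval p) ->
          (p \in C) = (p \in D)].

Definition regular (B' : {set B}) (P : {set {set B}}) : Prop :=
  exists f : 'rV[R]_d -> R,
    [/\ {within polytope B', continuous f},
        @convex_function R 'rV[R]_d (polytope B') f
      & forall D : set 'rV[R]_d,
          maximal_linearity_domain (polytope B') f D <->
          exists2 C, C \in P & D = polytope C].

Definition regular_subdivision (B' : {set B}) (P : {set {set B}}) : Prop :=
  subdivision B' P /\ regular B' P.

Definition regular_triangulation (B' : {set B}) (T : {set {set B}}) : Prop :=
  regular_subdivision B' T /\ forall C, C \in T -> affinely_independent C.

Definition refines (T P : {set {set B}}) : Prop :=
  forall C, C \in T -> exists2 D, D \in P & C \subset D.

(* |det(p_1 - p_0, ..., p_d - p_0)| / d! for a simplex with vertex set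
   C = {p_0, ..., p_d}. *)
Definition simplex_vol (C : {set B}) : R :=
  let s := [seq fsval p | p <- enum C] in
  `|\det (\matrix_(i < d) (s`_i.+1 - s`_0))| / d`!%:R.

(* Each R^(B') is regarded as a subspace of R^B, by extension by zero. *)
Definition RB : vectType R := {ffun B -> R^o}.

Definition phi (T : {set {set B}}) : RB :=
  [ffun p : B => \sum_(C in T | p \in C) simplex_vol C].

(* The polytopes Sigma(B') and F_P are given as lists of vertices: the vertices
   of F_P are the phi_T with T refining P. *)
Definition secondary_polytope (B' : {set B}) : seq RB :=
  [seq phi T | T in [pred T | `[< regular_triangulation B' T >]]].

Definition secondary_face (B' : {set B}) (P : {set {set B}}) : seq RB :=
  [seq phi T | T in
    [pred T | `[< regular_triangulation B' T /\ refines T P >]]].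

(* Direction of the affine span of the polytope with vertices s; its dimension
   is that of the polytope. *)
Definition direction (s : seq RB) : {vspace RB} :=
  <<[seq x - y | x <- s, y <- s]>>%VS.

Definition sec_dir (B' : {set B}) : {vspace RB} :=
  direction (secondary_polytope B').

Definition coarse (B' : {set B}) (P : {set {set B}}) : Prop :=
  [/\ full_dim B', regular_subdivision B' P
    & (\dim (direction (secondary_face B' P))).+1 = \dim (sec_dir B')].

Definition barycenter (s : seq RB) : RB := (size s)%:R^-1 *: \sum_(x <- s) x.

(* Points out of Sigma(B') through F_P when F_P is a facet: the functional
   cutting out F_P is maximal on F_P and strictly smaller on average over all
   vertices of Sigma(B'). *)
Definition outer_normal (B' : {set B}) (P : {set {set B}}) : RB :=
  barycenter (secondary_face B' P) - barycenter (secondary_polytope B').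

(** * Orientations *)

(* Sign of the change of basis between two ordered bases of one and the same
   subspace (0 if b and c are not such). *)
Definition relative_orientation (b c : seq RB) : int :=
  if [&& free b, free c & <<b>>%VS == <<c>>%VS] then
    sgz (\det (\matrix_(i < size b, j < size b) coord (in_tuple b) j c`_i))
  else 0.

(* For a polytope F with direction U, or(F) = H_c^(dim F)(Int F, k) is the line
   spanned by symbols [b], for b an ordered basis of U, subject to
   [c] = relative_orientation b c * [b].  An element x of the dual line is the
   function b |-> x([b]). *)
Definition or_dual (k : fieldType) (U : {vspace RB}) (x : seq RB -> k) : Prop :=
  (forall b, ~~ basis_of U b -> x b = 0) /\
  (forall b c, basis_of U b -> basis_of U c ->
     x c = (relative_orientation b c)%:~R * x b).

(* Matrix coefficient of the differential d : V -> S(V).  For P = {C_1,...,C_n}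
   coarse, Sigma(C_1) x ... x Sigma(C_n) is carried onto F_P by
   (x_1, ..., x_n) |-> x_1 + ... + x_n, so that F_P is oriented by the
   concatenation of bases b_i of the directions of the Sigma(C_i).  With the
   "outer normal first" convention the component of d[b] is
     boundary_coef * [b_1] . ... . [b_n],
   where b_i = vbasis (sec_dir C_i). *)
Definition boundary_coef (n : nat) (B' : {set B}) (b : seq RB)
    (s : n.-tuple {set B}) : int :=
  if `[< uniq s /\ coarse B' [set C in (s : seq {set B})]%SET >] then
    relative_orientation b
      (outer_normal B' [set C in (s : seq {set B})]%SET ::
       flatten [seq (vbasis (sec_dir C) : seq RB) | C <- s])
  else 0.

End Secondary.

Section OrientationFacts.
Variables (R : realType) (d : nat) (B : {fset 'rV[R]_d}).
Implicit Types (b c e : seq (RB B)) (U : {vspace RB B}).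

Let coord_mx (n : nat) (b c : n.-tuple (RB B)) : 'M[R]_n :=
  \matrix_(i < n, j < n) coord b j (c`_i).

Let relative_orientationE (n : nat) U (b c : n.-tuple (RB B)) :
  basis_of U b -> basis_of U c ->
  relative_orientation b c = sgz (\det (coord_mx b c)).
Proof.
move=> Ub Uc; rewrite /relative_orientation (basis_free Ub) (basis_free Uc).
rewrite (span_basis Ub) (span_basis Uc) eqxx /= /coord_mx.
case: b Ub => b sb Ub /=; have E := eqP sb; subst n.
by rewrite (_ : Tuple sb = in_tuple b) //; apply: val_inj.
Qed.

Let relative_orientation_refl U b :
  basis_of U b -> relative_orientation b b = 1.
Proof.
move=> Ub; have Ub' : basis_of U (in_tuple b) by [].
rewrite (relative_orientationE Ub' Ub') (_ : coord_mx _ _ = 1%:M).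
  by rewrite det1 sgz1.
apply/matrixP=> i j; rewrite !mxE coord_free ?(basis_free Ub') //.
Qed.

Let basis_size U b : basis_of U b -> size b == \dim U.
Proof. by move=> /andP[/eqP <- /eqP ->]. Qed.

Lemma relative_orientation_trans U b c e :
  basis_of U b -> basis_of U c -> basis_of U e ->
  relative_orientation b e =
    relative_orientation b c * relative_orientation c e.
Proof.
move=> Ub Uc Ue.
have Utb : basis_of U (Tuple (basis_size Ub)) by [].
have Utc : basis_of U (Tuple (basis_size Uc)) by [].
have Ute : basis_of U (Tuple (basis_size Ue)) by [].
rewrite (relative_orientationE Utb Ute) (relative_orientationE Utb Utc).
rewrite (relative_orientationE Utc Ute) -sgzM mulrC -det_mulmx.
congr (sgz (\det _)); apply/matrixP=> i j; rewrite !mxE.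
have ei : e`_i \in U.
  by rewrite (basis_mem Ue) // mem_nth // (eqP (basis_size Ue)).
rewrite {1}[e`_i](coord_basis Utc ei) linear_sum /=.
by apply: eq_bigr => m _; rewrite linearZ /= !mxE.
Qed.

Lemma relative_orientation_sym U b c :
  basis_of U b -> basis_of U c ->
  relative_orientation b c = relative_orientation c b.
Proof.
move=> Ub Uc.
have /esym := relative_orientation_trans Ub Uc Ub.
rewrite (relative_orientation_refl Ub) /relative_orientation.
case: ifP => _; case: ifP => _; rewrite ?mul0r ?mulr0 //.
by case: sgzP => _; case: sgzP => _; rewrite ?mul0r ?mulr0 ?mul1r ?mulN1r.
Qed.

Lemma relative_orientation_eq0 U b c :
  basis_of U b -> ~~ basis_of U c -> relative_orientation b c = 0.
Proof.
move=> Ub; apply: contraNeq; rewrite /relative_orientation.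
case: ifP => [/and3P[_ fc /eqP E] _|_]; last by rewrite eqxx.
by rewrite /basis_of -E (span_basis Ub) eqxx fc.
Qed.

Lemma or_dual_relative_orientation (k : fieldType) U c :
  or_dual U (fun b =>
    if basis_of U b then (relative_orientation b c)%:~R else 0 : k).
Proof.
split=> [b /negPf-> //|b e Ub Ue]; rewrite Ub Ue.
have [Uc|nUc] := boolP (basis_of U c); last first.
  by rewrite !(@relative_orientation_eq0 U _ c) // mulr0z mulr0.
by rewrite (relative_orientation_trans Ue Ub Uc)
  (relative_orientation_sym Ue Ub) intrM.
Qed.

End OrientationFacts.

(** * L-infinity algebras *)

(* The underlying data of an L-infinity algebra h: a graded vector space and
   the brackets lambda_n, i.e. the components h^(x n) -> h of the differential
   of S(h^*[-1]).  [component i] is the projection to the summand of degree i.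
   The identities expressing that the differential squares to zero are not
   recorded; they pass to every graded subspace closed under the brackets. *)
Record Linfty_data (k : fieldType) := MkLinfty {
  Lspace :> lmodType k;
  component : int -> Lspace -> Lspace;
  bracket : forall n : nat, ('I_n -> Lspace) -> Lspace
}.

Section LinftySub.
Variables (k : fieldType) (L : Linfty_data k).

Definition graded_subspace (I : set L) : Prop :=
  [/\ I 0,
      forall x y, I x -> I y -> I (x + y),
      forall (a : k) x, I x -> I (a *: x)
    & forall i x, I x -> I (component i x)].

Definition Linfty_subalgebra (I : set L) : Prop :=
  graded_subspace I /\
  forall n (x : 'I_n -> L), (0 < n)%N -> (forall i, I (x i)) -> I (bracket x).

(* I is an ideal of G, for G a subalgebra of L. *)
Definition Linfty_ideal (G I : set L) : Prop :=
  [/\ graded_subspace I, I `<=` G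
    & forall n (x : 'I_n -> L), (0 < n)%N -> (forall i, G (x i)) ->
        (exists i, I (x i)) -> I (bracket x)].

Definition direct_sum (G H I : set L) : Prop :=
  [/\ H `<=` G, I `<=` G,
      forall x, G x -> exists y z, [/\ H y, I z & x = y + z]
    & forall x, H x -> I x -> x = 0].

(* G is the semi-direct product of the subalgebra H and the ideal I. *)
Definition semidirect_product (G H I : set L) : Prop :=
  [/\ Linfty_subalgebra G, direct_sum G H I, Linfty_subalgebra H
    & Linfty_ideal G I].

End LinftySub.

(** * The algebra of all marked polytopes *)

Section PolytopeAlgebra.
Variables (R : realType) (k : fieldType) (d : nat) (B : {fset 'rV[R]_d}).

(* x = (x_B')_B' lies in the sum of the E_B' = or(Sigma(B'))^*. *)
Definition polytope_cochain (x : {set B} -> seq (RB B) -> k^o) : Prop :=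
  forall B', (full_dim B' -> or_dual (sec_dir B') (x B')) /\
             (~ full_dim B' -> x B' = 0).

Definition polytope_cochain_pred : {pred {set B} -> seq (RB B) -> k^o} :=
  fun x => `[< polytope_cochain x >].

Lemma polytope_cochain_submod : submod_closed polytope_cochain_pred.
Proof.
split=> [|a x y /asboolP hx /asboolP hy]; apply/asboolP => B'; split.
- by move=> _; split=> // b c _ _; rewrite mulr0.
- by [].
- move=> fB; have [x0 xe] := (hx B').1 fB; have [y0 ye] := (hy B').1 fB.
  split=> [b nb|b c Ub Uc]; rewrite !fctE /=.
    by rewrite x0 // y0 // scaler0 addr0.
  by rewrite (xe b c) // (ye b c) // mulrDr /GRing.scale /= mulrCA.
- move=> nfB; have x0 := (hx B').2 nfB; have y0 := (hy B').2 nfB.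
  by rewrite [LHS](_ : _ = a *: x B' + y B') // x0 y0 scaler0 addr0.
Qed.

HB.instance Definition _ :=
  GRing.isSubmodClosed.Build k ({set B} -> seq (RB B) -> k^o)
    polytope_cochain_pred polytope_cochain_submod.

Record polytope_space := PolytopeSpace {
  cochain :> {set B} -> seq (RB B) -> k^o;
  _ : cochain \in polytope_cochain_pred
}.

HB.instance Definition _ := [isSub for cochain].
HB.instance Definition _ := [Choice of polytope_space by <:].
HB.instance Definition _ :=
  [SubChoice_isSubLmodule of polytope_space by <:].

Lemma cochainP (x : polytope_space) : polytope_cochain x.
Proof. by case: x => x hx; apply/asboolP. Qed.

(* E_B' = or(Sigma(B'))^*[-1 - dim Sigma(B')]. *)
Definition degree (B' : {set B}) : nat := (\dim (sec_dir B')).+1.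

Definition component_fun (i : int) (x : polytope_space) :
    {set B} -> seq (RB B) -> k^o :=
  fun B' => if (degree B')%:Z == i then x B' else 0.

Lemma component_cochain i x : component_fun i x \in polytope_cochain_pred.
Proof.
apply/asboolP => B'; rewrite /component_fun; case: ifP => _.
  exact: cochainP.
by split=> // _; split=> // b c _ _; rewrite mulr0.
Qed.

Definition polytope_component (i : int) (x : polytope_space) : polytope_space :=
  PolytopeSpace (component_cochain i x).

(* lambda_n is the transpose of the component V -> S^n(V) of d, where
   v_1 . ... . v_n is evaluated on (x_1, ..., x_n) by the signed sum over the
   orderings of the v_i; here these orderings are absorbed in the sum over
   tuples s.  The power of -1 is the decalage sign sum_i (n - i) |x_i| turning
   the symmetric brackets on h[1] = V^* into the antisymmetric ones on h. *)
Definition bracket_fun (n : nat) (x : 'I_n -> polytope_space) :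
    {set B} -> seq (RB B) -> k^o :=
  fun B' b =>
    if basis_of (sec_dir B') b then
      \sum_(s : n.-tuple {set B})
        (-1) ^+ (\sum_(i < n) (n - i.+1) * degree (tnth s i))%N *
        (boundary_coef B' b s)%:~R *
        \prod_(i < n) x i (tnth s i) (vbasis (sec_dir (tnth s i)))
    else 0.

Lemma bracket_cochain n (x : 'I_n -> polytope_space) :
  bracket_fun x \in polytope_cochain_pred.
Proof.
apply/asboolP => B'; split=> [fB|nfB].
  split=> [b /negPf nb|b c Ub Uc]; rewrite /bracket_fun ?nb // Ub Uc.
  rewrite mulr_sumr; apply: eq_bigr => s _; rewrite mulrA; congr (_ * _).
  rewrite mulrCA; congr (_ * _); rewrite /boundary_coef.
  case: ifP => _; last by rewrite mulr0.
  set e := _ :: _.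
  by have [_ /(_ b c Ub Uc)] := or_dual_relative_orientation k (sec_dir B') e;
    rewrite Ub Uc.
apply/funext => b; rewrite /bracket_fun; case: ifP => // _.
apply: big1 => s _; rewrite /boundary_coef; case: asboolP => [[_ []//]|_].
by rewrite mulr0 mul0r.
Qed.

Definition polytope_bracket (n : nat) (x : 'I_n -> polytope_space) :
  polytope_space := PolytopeSpace (bracket_cochain x).

Definition polytope_algebra : Linfty_data k :=
  MkLinfty polytope_component polytope_bracket.

(** * The geometric algebra *)

(* B' is the marking of Q' = Conv(B') by all points of B in Q'. *)
Definition geometric (B' : {set B}) : Prop :=
  full_dim B' /\ forall p : B, polytope B' (fsval p) -> p \in B'.

Definition geometric_algebra : set polytope_algebra :=
  [set x : polytope_space | forall B', ~ geometric B' -> x B' = 0].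

(* The sum of those E_B' in the geometric algebra for which Conv(B') belongs
   to the class K. *)
Definition geometric_part (K : set 'rV[R]_d -> Prop) : set polytope_algebra :=
  [set x : polytope_space |
    forall B', ~ (geometric B' /\ K (polytope B')) -> x B' = 0].

End PolytopeAlgebra.

Arguments geometric_algebra {R} k {d} B.
Arguments geometric_part {R} k {d} B K.

(** * Finite and infinite subpolytopes *)

Definition finite_polytope (R : realType) (d : nat) (A : {fset 'rV[R]_d})
  (Q : set 'rV[R]_d) : Prop := forall v, vertex_of Q v -> v \in A.

Definition infinite_polytope (R : realType) (d : nat) (oo : 'rV[R]_d)
  (Q : set 'rV[R]_d) : Prop := Q oo.

(* Main.v *)
Require Import Defs.
From HB Require Import structures.
From mathcomp Require Import all_boot all_order all_algebra finmap.
From mathcomp Require Import all_classical all_reals all_analysis.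
From mathcomp Require Import ring.
Set Implicit Arguments.
Unset Strict Implicit.
Unset Printing Implicit Defensive.
Import Order.TTheory GRing.Theory Num.Theory.
Import numFieldNormedType.Exports.
Local Open Scope classical_set_scope.
Local Open Scope ring_scope.

(** The structure constants of the bracket are supported on coarse subdivisions:
    the component of [lambda_n (x_1, ..., x_n)] on a marked polytope [B'] is a
    sum over the coarse subdivisions of [B'] into [n] pieces [C_1, ..., C_n], of
    terms divisible by every [x_i C_i].  All closure properties thus reduce to
    statements about how a polytope inherits properties from the pieces of a
    subdivision of it ([bracket_supported]):
    - if every piece is marked by all the points of the ambient set that it
      contains, then so is the whole, since the pieces cover it
      ([subdivision_geometric]);
    - if every piece is finite, then so is the whole, since a vertex of the
      whole lies in some piece and is a vertex of that piece
      ([subdivision_finite]);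
    - if one piece contains the point at infinity, then so does the whole.

    The decomposition into a direct sum says that a polytope with vertices in
    [oo |` A] is either finite or infinite and not both.  A vertex of a convex
    hull is one of the generating points, so that a polytope which is not finite
    has [oo] among its generators; and if a polytope contains [oo], which is a
    vertex of the convex hull of [oo |` A], then [oo] is a vertex of that
    polytope, which is not finite because [oo] is not in [A]. *)

(** * Vertices of convex hulls *)

Section ConvexHull.
Variables (R : realType) (d : nat).
Implicit Types (Q S : set 'rV[R]_d) (v : 'rV[R]_d).

Lemma convex_hull_subset S1 S2 :
  S1 `<=` S2 -> convex_hull S1 `<=` convex_hull S2.
Proof.
by move=> S12 x S1x M [cM S2M]; apply: S1x; split=> //; apply: subset_trans S2M.
Qed.

Lemma convex_open_halfspace (l : 'cV[R]_d) (c : R) :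
  @convex_set R 'rV[R]_d [set x : 'rV[R]_d | (x *m l) 0 0 < c].
Proof.
move=> x y t; rewrite !inE /= => xc yc.
rewrite [conv t x y](_ : _ =
  t%:num *: (x : 'rV[R]_d) + (1 - t%:num) *: (y : 'rV[R]_d)) //.
have x0 : 0 < c - (x *m l) 0 0 by rewrite subr_gt0.
have y0 : 0 < c - (y *m l) 0 0 by rewrite subr_gt0.
have := convR_gt0 t x0 y0; rewrite convRE => t0; rewrite -subr_gt0.
congr (is_true (0 < _)): t0.
by rewrite mulmxDl -!scalemxAl !mxE /unstable.onem; ring.
Qed.

(** If [v] were not in [S], the functional exposing [v] would be strictly below
    its maximum on [S], hence on the convex hull of [S], which contains [v]. *)
Lemma vertex_of_convex_hull S v : vertex_of (convex_hull S) v -> S v.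
Proof.
move=> [l [c [lec E]]].
have [hv /= lv] : (convex_hull S `&` [set x | (x *m l) 0 0 = c]) v by rewrite -E.
apply: contrapT => nSv.
have /(_ v hv) /= : convex_hull S `<=` [set x : 'rV[R]_d | (x *m l) 0 0 < c].
  apply: smallest_sub; first exact: convex_open_halfspace.
  move=> x Sx /=; have hx : convex_hull S x by apply: sub_gen_smallest.
  rewrite lt_neqAle lec // andbT; apply/eqP => lx; apply: nSv.
  by have <- : x = v by rewrite -[x = v]/([set v] x) E.
by rewrite lv ltxx.
Qed.

Lemma vertex_of_subset Q Q' v :
  Q' `<=` Q -> Q' v -> vertex_of Q v -> vertex_of Q' v.
Proof.
move=> Q'Q Q'v [l [c [lec E]]]; exists l, c; split=> [x /Q'Q/lec//|].
apply/seteqP; split=> [x -> | x [Q'x lx]].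
  have [_ lv] : (Q `&` [set x | (x *m l) 0 0 = c]) v by rewrite -E.
  by split.
by rewrite E; split=> //; apply: Q'Q.
Qed.

End ConvexHull.

(** * Properties inherited along subdivisions *)

Section Subdivision.
Variables (R : realType) (d : nat) (B : {fset 'rV[R]_d}).
Implicit Types (C D : {set B}) (P : {set {set B}}).

Lemma polytope_subset C D : C \subset D -> polytope C `<=` polytope D.
Proof.
move=> /fintype.subsetP CB; apply: convex_hull_subset => _ [p /= Cp <-].
by exists p => //=; apply: CB.
Qed.

Lemma subdivision_piece D P C :
  subdivision D P -> C \in P -> polytope C `<=` polytope D.
Proof. by move=> [sub _ _ _] /sub[CB _]; apply: polytope_subset. Qed.

Lemma subdivision_cover D P x : subdivision D P -> polytope D x ->
  exists2 C, C \in P & polytope C x.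
Proof. by move=> [_ cov _ _]; rewrite -cov => -[C /= PC Cx]; exists C. Qed.

Lemma subdivision_geometric D P : full_dim D -> subdivision D P ->
  (forall C, C \in P -> Defs.geometric C) -> Defs.geometric D.
Proof.
move=> fB sP gP; split=> // p /(subdivision_cover sP)[C PC Cp].
have [/(_ C PC)[/fintype.subsetP CB _] _ _ _] := sP.
by apply: CB; apply: (gP C PC).2.
Qed.

Lemma subdivision_finite (A : {fset 'rV[R]_d}) D P : subdivision D P ->
  (forall C, C \in P -> finite_polytope A (polytope C)) ->
  finite_polytope A (polytope D).
Proof.
move=> sP fP v vB.
have Bv : polytope D v.
  have [l [c [_ E]]] := vB.
  by have [] : (polytope D `&` [set x | (x *m l) 0 0 = c]) v by rewrite -E.
have [C PC Cv] := subdivision_cover sP Bv.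
apply: (fP C PC); apply: vertex_of_subset vB => //.
exact: subdivision_piece PC.
Qed.

End Subdivision.

(** * Finite and infinite polytopes *)

Section FiniteInfinite.
Variables (R : realType) (d : nat) (A : {fset 'rV[R]_d}) (oo : 'rV[R]_d).
Let At : {fset 'rV[R]_d} := (oo |` A)%fset.

Lemma finite_or_infinite (C : {set At}) :
  finite_polytope A (polytope C) \/ infinite_polytope oo (polytope C).
Proof.
have [|nf] := pselect (finite_polytope A (polytope C)); [by left|right].
apply: contrapT => Coo; apply: nf => v vC.
have [p /= Cp pv] := vertex_of_convex_hull vC.
have := valP p; rewrite /= in_fset1U pv => /orP[/eqP voo|//].
by case: Coo; rewrite -voo -pv; apply: sub_gen_smallest; exists p.
Qed.

Lemma infinite_not_finite (C : {set At}) : oo \notin A ->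
  vertex_of (convex_hull [set` At]) oo -> infinite_polytope oo (polytope C) ->
  ~ finite_polytope A (polytope C).
Proof.
move=> /negP nA voo Coo fC; apply: nA; apply: fC.
apply: vertex_of_subset voo => //; apply: convex_hull_subset => _ [p _ <-].
exact: valP p.
Qed.

End FiniteInfinite.

(** * Supports and brackets *)

Section Supported.
Variables (R : realType) (k : fieldType) (d : nat) (B : {fset 'rV[R]_d}).
Implicit Types (S T : {set B} -> Prop).

(** The common form of the geometric algebra and of its parts: the sum of the
    summands [E_B'] with [B'] in the class [S]. *)
Definition supported_on S : set (polytope_algebra k B) :=
  [set x : polytope_space k B | forall B', ~ S B' -> x B' = 0].

Lemma supported_on_graded S : graded_subspace (supported_on S).
Proof.
split=> [B' _ //|x y Sx Sy B' nS|a x Sx B' nS|i x Sx B' nS].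
- by rewrite [LHS](_ : _ = (x : polytope_space k B) B' +
    (y : polytope_space k B) B') // Sx // Sy // addr0.
- by rewrite [LHS](_ : _ = a *: (x : polytope_space k B) B') // Sx // scaler0.
- by rewrite /= /component_fun; case: ifP => // _; apply: Sx.
Qed.

(** A nonzero term of the bracket comes from a coarse subdivision whose pieces
    lie in the supports of the arguments. *)
Lemma bracket_supported n (S : 'I_n -> {set B} -> Prop) T
    (x : 'I_n -> polytope_algebra k B) :
  (forall B' (s : n.-tuple {set B}), full_dim B' ->
     subdivision B' [set C in (s : seq {set B})]%SET ->
     (forall i, S i (tnth s i)) -> T B') ->
  (forall i, supported_on (S i) (x i)) -> supported_on T (bracket x).
Proof.
move=> ST Sx B' nT; apply/funext => b /=; rewrite /bracket_fun.
case: ifP => // _; apply: big1 => s _; rewrite /boundary_coef.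
case: asboolP => [[_ [fB [sub _] _]]|_]; last by rewrite mulr0 mul0r.
have [i nSi] : exists i, ~ S i (tnth s i).
  apply: contrapT => /forallNP nS; apply/nT/(ST B' s) => // i.
  exact: contrapT.
have xi0 c : (x i : polytope_space k B) (tnth s i) c = 0.
  by have /= -> := Sx i _ nSi.
by rewrite [X in _ * X](bigD1 i) //= xi0 mul0r mulr0.
Qed.

Section Restriction.
Variables (S : {set B} -> Prop) (x : polytope_space k B).

Definition restriction_fun : {set B} -> seq (RB B) -> k^o :=
  fun B' => if `[< S B' >] then x B' else 0.

Lemma restriction_cochain : restriction_fun \in @polytope_cochain_pred R k d B.
Proof.
apply/asboolP => B'; rewrite /restriction_fun; case: ifP => _.
  exact: cochainP.
by split=> // _; split=> // b c _ _; rewrite mulr0.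
Qed.

Definition restriction : polytope_algebra k B :=
  PolytopeSpace restriction_cochain.

End Restriction.

Lemma restriction_supported S x : supported_on S (restriction S x).
Proof. by move=> B' nS /=; rewrite /restriction_fun asboolF. Qed.

Lemma supported_on_subset S T :
  (forall B', S B' -> T B') -> supported_on S `<=` supported_on T.
Proof. by move=> ST x Sx B' nT; apply: Sx => /ST. Qed.

Lemma supported_on_direct_sum G S T :
  (forall B', G B' <-> S B' \/ T B') -> (forall B', S B' -> ~ T B') ->
  direct_sum (supported_on G) (supported_on S) (supported_on T).
Proof.
move=> GST ST; split.
- by apply: supported_on_subset => B' SB; apply/GST; left.
- by apply: supported_on_subset => B' TB; apply/GST; right.
- move=> x Gx; exists (restriction S x), (restriction T x).
  split; [exact: restriction_supported|exact: restriction_supported|].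
  apply: val_inj; apply/funext => B'.
  rewrite [RHS](_ : _ = restriction_fun S x B' + restriction_fun T x B') //.
  rewrite /restriction_fun; case: asboolP => SB.
    by rewrite asboolF ?addr0 //; apply: ST.
  case: asboolP => TB; first by rewrite add0r.
  by rewrite addr0; apply: Gx => /GST[].
- move=> x Sx Tx; apply: val_inj; apply/funext => B'.
  by have [/ST/Tx|/Sx] := pselect (S B').
Qed.

End Supported.

(** * The semi-direct product decomposition *)

Theorem proposition6p2 (R : realType) (k : fieldType) (d : nat)
    (A : {fset 'rV[R]_d}) (oo : 'rV[R]_d) :
  [pchar k] =i pred0 ->
  affinely_spanning [set` A] ->
  oo \notin A ->
  let At : {fset 'rV[R]_d} := (oo |` A)%fset in
  vertex_of (convex_hull [set` At]) oo ->
  general_position At ->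
  let gt := geometric_algebra k At in
  let g := geometric_part k At (finite_polytope A) in
  let goo := geometric_part k At (infinite_polytope oo) in
  [/\ Linfty_subalgebra g,
      Linfty_subalgebra goo,
      Linfty_ideal gt goo
    & semidirect_product gt g goo].
Proof.
move=> _ _ ooA At voo _ gt g goo.
pose fin C := Defs.geometric C /\ finite_polytope A (@polytope R d At C).
pose inf C := Defs.geometric C /\ infinite_polytope oo (@polytope R d At C).
have subg : Linfty_subalgebra g.
  split=> [|n x _ gx]; first exact: supported_on_graded.
  apply: (bracket_supported (S := fun=> fin)) gx => B' s fB sub fs.
  have fP C : C \in [set C in (s : seq _)]%SET -> fin C.
    by rewrite inE => /tnthP[i ->]; apply: fs.
  split; first by apply: subdivision_geometric sub _ => // C /fP[].
  by apply: subdivision_finite sub _ => C /fP[].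
have subgt : Linfty_subalgebra gt.
  split=> [|n x _ gx]; first exact: supported_on_graded.
  apply: (bracket_supported (S := fun=> @Defs.geometric R d At)) gx.
  move=> B' s fB sub gs.
  apply: subdivision_geometric sub _ => // C.
  by rewrite inE => /tnthP[i ->]; apply: gs.
have ideal : Linfty_ideal gt goo.
  split; first exact: supported_on_graded.
    by apply: supported_on_subset => B' [].
  move=> n x _ gx [i0 goox].
  (* Only the argument at [i0] is known to be supported on infinite polytopes. *)
  pose S i := if i == i0 then inf else @Defs.geometric R d At.
  apply: (bracket_supported (S := S)) => [B' s fB sub gs|i].
    have mem i : tnth s i \in [set C in (s : seq _)]%SET by rewrite inE mem_tnth.
    split.
      apply: subdivision_geometric sub _ => // C.
      rewrite inE => /tnthP[i ->]; move: (gs i); rewrite /S; case: ifP => _ //.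
      by case.
    have := gs i0; rewrite /S eqxx => -[_].
    exact: (subdivision_piece sub (mem i0)).
  by rewrite /S; case: eqP => [->|_]; [exact: goox|exact: gx].
have subgoo : Linfty_subalgebra goo.
  have [gr sub br] := ideal; split=> // n x n0 goox.
  by apply: br => // [i|]; [apply: sub|exists (Ordinal n0)].
split=> //; split=> //; apply: supported_on_direct_sum => B'.
  split=> [gB|[[]|[]]//].
  by have [fB|iB] := finite_or_infinite B'; [left|right].
by move=> [_ fB] [_ iB]; apply: infinite_not_finite iB fB.
Qed.
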